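(* Let $n\ge 1$ and let $\mathfrak{w}_n$ be the Lie algebra of all derivations of $\mathbb{C}[x_1,\dots,x_n]$, with $\mathfrak{h},\mathfrak{n}_+,\mathfrak{n}_-\subset\mathfrak{w}_n$ as defined in the context. (i) There is a decomposition $\mathfrak{w}_n=\mathfrak{n}_-\oplus\mathfrak{h}\oplus\mathfrak{n}_+$ into a (vector space) direct sum of Lie subalgebras. (ii) Both $(\mathfrak{w}_n,\mathfrak{n}_-)$ and $(\mathfrak{w}_n,\mathfrak{n}_+)$ are Whittaker pairs.
   Context: Everything is over $\mathbb{C}$. For $i\in\{1,\dots,n\}$ and $\mathbf{m}=(m_1,\dots,m_n)\in\{0,1,2,\dots\}^n$ let $D_i(\mathbf{m})=x_1^{m_1}\cdots x_n^{m_n}\frac{\partial}{\partial x_i}$; these form a basis of $\mathfrak{w}_n$. $\mathfrak{h}$ is the linear span of $x_i\frac{\partial}{\partial x_i}$, $i=1,\dots,n$. $\mathfrak{a}\cong\mathfrak{gl}_n$ is the linear span of $x_i\frac{\partial}{\partial x_j}$, $i,j\in\{1,\dots,n\}$, with Cartan subalgebra $\mathfrak{h}$. Fix a (usual) triangular decomposition $\mathfrak{a}=\mathfrak{n}_-^{\mathfrak{a}}\oplus\mathfrak{h}\oplus\mathfrak{n}_+^{\mathfrak{a}}$. $\mathfrak{n}_+$ is the linear span of $\mathfrak{n}_+^{\mathfrak{a}}$ and the elements $\frac{\partial}{\partial x_i}$, $i=1,\dots,n$. $\mathfrak{n}_-$ is the linear span of $\mathfrak{n}_-^{\mathfrak{a}}$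 and all elements $D_i(\mathbf{m})$ which are contained in neither $\mathfrak{a}$ nor $\mathfrak{n}_+$. For a Lie algebra $\mathfrak{n}$ put $\mathfrak{n}_0=\mathfrak{n}$, $\mathfrak{n}_i=[\mathfrak{n}_{i-1},\mathfrak{n}]$ for $i>0$; $\mathfrak{n}$ is quasi-nilpotent if $\bigcap_{i\ge0}\mathfrak{n}_i=0$. A pair $(\mathfrak{g},\mathfrak{n})$ of a Lie algebra and a subalgebra is a Whittaker pair if $\mathfrak{n}$ is quasi-nilpotent and $\mathfrak{n}$ acts locally nilpotently on the adjoint $\mathfrak{n}$-module $\mathfrak{g}/\mathfrak{n}$; this includes that $\mathfrak{g}/\mathfrak{n}$ is a locally finite $\mathfrak{n}$-module ($\dim U(\mathfrak{n})w<\infty$ for all $w$), together with $\mathrm{ad}_u^k(w)=0$ for $k\gg0$ for all $u\in\mathfrak{n}$, $w\in\mathfrak{g}/\mathfrak{n}$. *)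

(* Defs.v *)
From HB Require Import structures.
From mathcomp Require Import all_boot all_order all_algebra.
From mathcomp Require Import generic_quotient ring_quotient.
From mathcomp Require Import boolp reals mpoly complex.

Set Implicit Arguments.
Unset Strict Implicit.
Unset Printing Implicit Defensive.

Import GRing.Theory.
Local Open Scope ring_scope.
Local Open Scope quotient_scope.

Section Span.
Variables (K : fieldType) (V : lmodType K).
Implicit Type X : V -> Prop.

Definition span X : {pred V} := fun v =>
  `[< exists s : seq (K * V),
        (forall p, p \in s -> X p.2) /\ v = \sum_(p <- s) p.1 *: p.2 >].

Lemma span_submod X : submod_closed (span X).
Proof.
split; first by apply/asboolP; exists [::]; rewrite big_nil.
move=> a u v /asboolP[s [sX ->]] /asboolP[t [tX ->]]; apply/asboolP.
exists ([seq (a * p.1, p.2) | p <- s] ++ t); split.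
  by move=> p; rewrite mem_cat => /orP[/mapP[q qs ->]|] /=; [apply: sX|apply: tX].
rewrite big_cat big_map scaler_sumr; congr (_ + _).
by apply: eq_bigr => p _; rewrite scalerA.
Qed.

HB.instance Definition _ X :=
  GRing.isSubmodClosed.Build K V (span X) (span_submod X).

Definition finite_dim (S : {pred V}) : Prop :=
  exists b : seq V, S =i span (fun v => v \in b).

Definition direct_sum3 (A B C : {pred V}) : Prop :=
  forall v, exists! t : V * V * V,
    [/\ t.1.1 \in A, t.1.2 \in B, t.2 \in C & v = t.1.1 + t.1.2 + t.2].

End Span.

(* The quotient {ideal_quot S} of ring_quotient is only a zmodType; quot_mod S is
   the same type with its K-module structure. *)
Section QuotMod.
Variables (K : fieldType) (V : lmodType K) (S : submodClosed V).

(* In the hierarchy submodClosed does not inherit from zmodClosed, which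
   {ideal_quot _} expects; submod_pred S is S, recorded as a zmodClosed. *)
Definition submod_pred : {pred V} := S.
Fact submod_pred_zmod : zmod_closed submod_pred.
Proof. exact: (submodClosedP S). Qed.
HB.instance Definition _ := GRing.isZmodClosed.Build V submod_pred submod_pred_zmod.

Definition quot_mod := {ideal_quot submod_pred}.
HB.instance Definition _ := GRing.Zmodule.on quot_mod.
HB.instance Definition _ := EqQuotient.on quot_mod.

Lemma quot_modE (x y : V) :
  (\pi_quot_mod x = \pi_quot_mod y) <-> (x - y \in S).
Proof.
by rewrite -[x - y \in S]/(x - y \in submod_pred) Quotient.idealrBE; split=> /eqP.
Qed.

Lemma quot_modD (x y : V) :
  \pi_quot_mod (x + y) = \pi_quot_mod x + \pi_quot_mod y.
Proof. exact: (raddfD \pi_{ideal_quot submod_pred}). Qed.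

Definition quot_scale (a : K) (w : quot_mod) : quot_mod :=
  \pi_quot_mod (a *: repr w).

Lemma quot_scale_pi a x : quot_scale a (\pi x) = \pi_quot_mod (a *: x).
Proof.
apply/quot_modE; rewrite -scalerBr rpredZ //.
by apply/quot_modE; rewrite reprK.
Qed.

Fact quot_scaleA a b w : quot_scale a (quot_scale b w) = quot_scale (a * b) w.
Proof. by rewrite -[w]reprK !quot_scale_pi scalerA. Qed.

Fact quot_scale1 : left_id 1 quot_scale.
Proof. by move=> w; rewrite /quot_scale scale1r reprK. Qed.

Fact quot_scaleDr : right_distributive quot_scale +%R.
Proof.
move=> a u v; rewrite -[u]reprK -[v]reprK -quot_modD !quot_scale_pi.
by rewrite -quot_modD scalerDr.
Qed.

Fact quot_scaleDl w : {morph quot_scale^~ w : a b / a + b}.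
Proof. by move=> a b; rewrite /quot_scale scalerDl quot_modD. Qed.

HB.instance Definition _ := GRing.Zmodule_isLmodule.Build K quot_mod
  quot_scaleA quot_scale1 quot_scaleDr quot_scaleDl.

End QuotMod.

HB.mixin Record Lmodule_isLie (K : fieldType) L of GRing.Lmodule K L := {
  lie : L -> L -> L;
  lie_linearl : forall y, linear (lie^~ y);
  lie_linearr : forall x, linear (lie x);
  liexx : forall x, lie x x = 0;
  lie_jacobi : forall x y z,
    lie x (lie y z) + lie y (lie z x) + lie z (lie x y) = 0
}.
#[short(type="lieAlgType")]
HB.structure Definition LieAlgebra (K : fieldType) :=
  {L of Lmodule_isLie K L & GRing.Lmodule K L}.

Section WhittakerPair.
Variables (K : fieldType) (L : lieAlgType K).
Implicit Type N : submodClosed L.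

Definition lie_subalgebra N : Prop :=
  forall x y, x \in N -> y \in N -> lie x y \in N.

Fixpoint lower_central N (i : nat) : {pred L} :=
  if i is i'.+1 then
    span (fun v => exists x y,
            [/\ x \in lower_central N i', y \in N & v = lie x y])
  else N.

Definition quasi_nilpotent N : Prop :=
  forall v, (forall i, v \in lower_central N i) -> v = 0.

(* In the next definitions act : L -> V -> V is the action of the elements of
   N on a module V; act u is irrelevant for u outside N. *)

(* U(N) w: as U(N) is spanned by the monomials u_1 ... u_k (k >= 0) in
   elements of N, this is the span of all u_1 . (... (u_k . w)). *)
Definition envelope_orbit N (V : lmodType K) (act : L -> V -> V) (w : V) :
    {pred V} :=
  span (fun v => exists us : seq L,
          (forall u, u \in us -> u \in N) /\ v = foldr act w us).

Definition locally_finite N (V : lmodType K) (act : L -> V -> V) : Prop :=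
  forall w, finite_dim (envelope_orbit N act w).

Definition locally_nilpotent N (V : lmodType K) (act : L -> V -> V) : Prop :=
  locally_finite N act /\
  forall u w, u \in N ->
    exists k0, forall k, (k0 <= k)%N -> iter k (act u) w = 0.

Definition ad_quot N (u : L) (w : quot_mod N) : quot_mod N :=
  \pi_(quot_mod N) (lie u (repr w)).

(* ad_quot does not depend on representatives. *)
Lemma ad_quot_pi N u x : lie_subalgebra N -> u \in N ->
  ad_quot u (\pi_(quot_mod N) x) = \pi_(quot_mod N) (lie u x).
Proof.
move=> subN uN; apply/quot_modE.
have lieB y z : lie u y - lie u z = lie u (y - z).
  by rewrite addrC -scaleN1r -lie_linearr scaleN1r addrC.
by rewrite lieB; apply: subN => //; apply/quot_modE; rewrite reprK.
Qed.

Definition whittaker_pair N : Prop :=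
  [/\ lie_subalgebra N, quasi_nilpotent N & locally_nilpotent N (@ad_quot N)].

End WhittakerPair.

Section Derivations.
Variables (K : fieldType) (A : algType K).

Record derivation := Derivation {
  der_fun :> A -> A;
  der_linear : linear der_fun;
  derM : forall p q, der_fun (p * q) = der_fun p * q + p * der_fun q
}.

Lemma derP (D E : derivation) : D =1 E -> D = E.
Proof.
case: D E => [D lD mD] [E lE mE] /= /funext eDE; move: lD mD; rewrite eDE.
by move=> lD mD; congr Derivation; apply: Prop_irrelevance.
Qed.

HB.instance Definition _ := gen_eqMixin derivation.
HB.instance Definition _ := gen_choiceMixin derivation.

Implicit Types D E F : derivation.

Lemma derD D p q : D (p + q) = D p + D q.
Proof. by have := der_linear D 1 p q; rewrite !scale1r. Qed.
Lemma derZ D a p : D (a *: p) = a *: D p.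
Proof.
have D0 : D 0 = 0 by apply: (@addrI _ (D 0)); rewrite -derD !addr0.
by have := der_linear D a p 0; rewrite D0 !addr0.
Qed.
Lemma derN D p : D (- p) = - D p.
Proof. by rewrite -scaleN1r derZ scaleN1r. Qed.

Fact der0_linear : linear (fun _ : A => 0 : A).
Proof. by move=> a p q; rewrite scaler0 addr0. Qed.
Fact der0M p q : 0 = 0 * q + p * 0 :> A.
Proof. by rewrite mul0r mulr0 addr0. Qed.
Definition der0 := Derivation der0_linear der0M.

Fact der_opp_linear D : linear (fun p : A => - D p : A).
Proof. by move=> a p q; rewrite der_linear opprD scalerN. Qed.
Fact der_oppM D p q : - D (p * q) = - D p * q + p * - D q.
Proof. by rewrite derM opprD mulNr mulrN. Qed.
Definition der_opp D := Derivation (der_opp_linear D) (der_oppM D).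

Fact der_add_linear D E : linear (fun p : A => D p + E p : A).
Proof. by move=> a p q; rewrite !der_linear scalerDr addrACA. Qed.
Fact der_addM D E p q :
  D (p * q) + E (p * q) = (D p + E p) * q + p * (D q + E q).
Proof. by rewrite !derM mulrDl mulrDr addrACA. Qed.
Definition der_add D E := Derivation (der_add_linear D E) (der_addM D E).

Fact der_scale_linear a D : linear (fun p : A => a *: D p : A).
Proof. by move=> b p q; rewrite der_linear scalerDr !scalerA mulrC. Qed.
Fact der_scaleM a D p q : a *: D (p * q) = (a *: D p) * q + p * (a *: D q).
Proof. by rewrite derM scalerDr scalerAl scalerAr. Qed.
Definition der_scale a D :=
  Derivation (der_scale_linear a D) (der_scaleM a D).

Fact der_lie_linear D E : linear (fun p : A => D (E p) - E (D p) : A).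
Proof. by move=> a p q; rewrite !der_linear scalerBr opprD addrACA. Qed.
Fact der_lieM D E p q :
  D (E (p * q)) - E (D (p * q)) =
    (D (E p) - E (D p)) * q + p * (D (E q) - E (D q)).
Proof.
rewrite !derM !derD !derM mulrBl mulrBr !opprD !addrA.
by rewrite [LHS](ACl (1*5*(4*8)*(2*7)*(3*6))) /= !subrr !addr0 addrA.
Qed.
Definition der_lie D E := Derivation (der_lie_linear D E) (der_lieM D E).

Fact der_addA : associative der_add.
Proof. by move=> D E F; apply: derP => p /=; rewrite addrA. Qed.
Fact der_addC : commutative der_add.
Proof. by move=> D E; apply: derP => p /=; rewrite addrC. Qed.
Fact der_add0 : left_id der0 der_add.
Proof. by move=> D; apply: derP => p /=; rewrite add0r. Qed.
Fact der_addN : left_inverse der0 der_opp der_add.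
Proof. by move=> D; apply: derP => p /=; rewrite addNr. Qed.
HB.instance Definition _ :=
  GRing.isZmodule.Build derivation der_addA der_addC der_add0 der_addN.

Fact der_scaleA a b D : der_scale a (der_scale b D) = der_scale (a * b) D.
Proof. by apply: derP => p /=; rewrite scalerA. Qed.
Fact der_scale1 : left_id 1 der_scale.
Proof. by move=> D; apply: derP => p /=; rewrite scale1r. Qed.
Fact der_scaleDr : right_distributive der_scale +%R.
Proof. by move=> a D E; apply: derP => p /=; rewrite scalerDr. Qed.
Fact der_scaleDl D : {morph der_scale^~ D : a b / a + b}.
Proof. by move=> a b; apply: derP => p /=; rewrite scalerDl. Qed.
HB.instance Definition _ := GRing.Zmodule_isLmodule.Build K derivation
  der_scaleA der_scale1 der_scaleDr der_scaleDl.

Fact der_lie_linearl E : linear (der_lie^~ E).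
Proof.
move=> a D F; apply: derP => p /=.
by rewrite derD derZ scalerBr opprD addrACA.
Qed.
Fact der_lie_linearr D : linear (der_lie D).
Proof.
move=> a E F; apply: derP => p /=.
by rewrite derD derZ scalerBr opprD addrACA.
Qed.
Fact der_liexx D : der_lie D D = 0.
Proof. by apply: derP => p /=; rewrite subrr. Qed.
Fact der_jacobi D E F :
  der_lie D (der_lie E F) + der_lie E (der_lie F D) + der_lie F (der_lie D E)
  = 0.
Proof.
apply: derP => p /=; rewrite !derD !derN !opprB !addrA !subrK.
by rewrite [LHS](ACl ((1*8)*(5*2)*(3*6)*(7*4))) /= !subrr !addr0.
Qed.
HB.instance Definition _ := Lmodule_isLie.Build K derivation
  der_lie_linearl der_lie_linearr der_liexx der_jacobi.

End Derivations.

Section Witt.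
Variables (K : fieldType) (n : nat).

Definition witt := derivation {mpoly K[n]}.
HB.instance Definition _ := LieAlgebra.on witt.

Implicit Types (i j : 'I_n) (m : 'X_{1..n}) (P : rel 'I_n).

Fact wittD_linear i m :
  linear (fun p : {mpoly K[n]} => 'X_[m] * p^`M(i) : {mpoly K[n]}).
Proof. by move=> a p q; rewrite linearP mulrDr scalerAr. Qed.
Fact wittDM i m (p q : {mpoly K[n]}) :
  'X_[m] * (p * q)^`M(i) = 'X_[m] * p^`M(i) * q + p * ('X_[m] * q^`M(i)).
Proof. by rewrite mderivM mulrDr (mulrCA p) -mulrA. Qed.

(* x^m d/dx_i; in particular d/dx_i is wittD i 0 and x_i d/dx_j is
   wittD j U_(i). *)
Definition wittD i m : witt := Derivation (wittD_linear i m) (wittDM i m).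

Definition witt_h : {pred witt} := span (fun D => exists i, D = wittD i U_(i)).
HB.instance Definition _ := GRing.SubmodClosed.on witt_h.

Definition witt_gl : {pred witt} :=
  span (fun D => exists i j, D = wittD j U_(i)).
HB.instance Definition _ := GRing.SubmodClosed.on witt_gl.

(* The triangular decompositions of gl_n with Cartan subalgebra witt_h
   correspond to the sets of positive roots.  x_i d/dx_j (i != j) has root
   e_i - e_j, so a set of roots is a relation P, P i j meaning that e_i - e_j
   is positive; e_i - e_j and e_k - e_l add up to a root iff, up to exchanging
   them, j = k and i != l, so closure under addition is transitivity. *)
Definition positive_system P : Prop :=
  [/\ irreflexive P, forall i j, i != j -> P i j = ~~ P j i & transitive P].

Definition witt_gl_plus P : {pred witt} :=
  span (fun D => exists i j, P i j /\ D = wittD j U_(i)).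

Definition witt_gl_minus P : {pred witt} :=
  span (fun D => exists i j, P j i /\ D = wittD j U_(i)).

Definition witt_plus P : {pred witt} :=
  span (fun D => D \in witt_gl_plus P \/ exists i, D = wittD i 0%MM).
HB.instance Definition _ P := GRing.SubmodClosed.on (witt_plus P).

Definition witt_minus P : {pred witt} :=
  span (fun D => D \in witt_gl_minus P \/
    exists i m, [/\ D = wittD i m, D \notin witt_gl & D \notin witt_plus P]).
HB.instance Definition _ P := GRing.SubmodClosed.on (witt_minus P).

End Witt.
Arguments witt_h : clear implicits.
Arguments witt_gl : clear implicits.
Arguments witt_gl_plus K [n] P _.
Arguments witt_gl_minus K [n] P _.
Arguments witt_plus K [n] P _.
Arguments witt_minus K [n] P _.

(* Main.v *)
From HB Require Import structures.
From mathcomp Require Import all_boot all_order all_algebra.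
From mathcomp Require Import boolp reals mpoly complex.
From mathcomp Require Import zify.
Require Import Defs.

(* Give x_k the integer degree g k = #{l | P k l} - (2n + 1) < 0, which makes
   w_n a Z-graded Lie algebra with x^m d/dx_i in degree sum_k m_k (g k) - g i.
   Then n_+, h and n_- are exactly the parts of positive, zero and negative
   degree, whence (i).  Since all g k have the same sign, every graded component
   is finite dimensional; a bracket with an element of n_+ raises the degree by
   at least 1, so the terms of the lower central series of n_+ lie in ever higher
   degrees, and U(n_+) w lives in the finitely many degrees between that of w
   and 0 when taken modulo n_+.  For n_- replace g with -g. *)

Set Implicit Arguments.
Unset Strict Implicit.
Unset Printing Implicit Defensive.

Import Order.TTheory GRing.Theory Num.Theory.
Local Open Scope ring_scope.
Local Open Scope quotient_scope.

(** * Spans and finite-dimensional subspaces *)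

Section LinearAlgebra.
Variables (K : fieldType) (V W : lmodType K).

Lemma mem_span (X : V -> Prop) v : X v -> v \in span X.
Proof.
move=> Xv; apply/asboolP; exists [:: (1, v)].
by split=> [p|]; rewrite ?big_seq1 ?scale1r // inE => /eqP->.
Qed.

Lemma span_linear_sub (f : V -> W) (X : V -> Prop) (S : submodClosed W) :
  linear f -> (forall v, X v -> f v \in S) ->
  forall v, v \in span X -> f v \in S.
Proof.
move=> f_lin fX v /asboolP[s [sX ->]].
have f0 : f 0 = 0 by have := f_lin (-1) 0 0; rewrite scaler0 addr0 scaleN1r addNr.
have -> : f (\sum_(p <- s) p.1 *: p.2) = \sum_(p <- s) p.1 *: f p.2.
  by elim: s {sX} => [|p s IHs]; rewrite ?big_nil // !big_cons f_lin IHs.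
rewrite big_seq; apply: rpred_sum => p ps.
by rewrite rpredZ // fX //; apply: sX.
Qed.

End LinearAlgebra.

Lemma span_sub (K : fieldType) (V : lmodType K) (X : V -> Prop)
    (S : submodClosed V) :
  (forall v, X v -> v \in S) -> {subset span X <= S}.
Proof. by move=> XS v; apply: (span_linear_sub (f := id)). Qed.

Lemma submodB (K : fieldType) (V : lmodType K) (S : submodClosed V) x y :
  x \in S -> y \in S -> x - y \in S.
Proof. by move=> xS yS; rewrite -scaleN1r rpredD // rpredZ. Qed.

Section FiniteDim.
Variables (K : fieldType) (V : lmodType K).
Implicit Types (S : submodClosed V) (b : seq V).

Lemma span_cons v b w :
  w \in span (fun u => u \in v :: b) ->
  exists c t, t \in span (fun u => u \in b) /\ w = c *: v + t.
Proof.
move=> /asboolP[s [sb ->]]; elim: s sb => [|p s IHs] sb.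
  by exists 0, 0; rewrite rpred0 scale0r addr0 big_nil.
case: IHs => [q qs|c [t [tb def_t]]]; first by apply: sb; rewrite inE qs orbT.
rewrite big_cons def_t.
have := sb p (mem_head _ _); rewrite inE => /predU1P[->|pb].
  by exists (p.1 + c), t; rewrite scalerDl addrA.
exists c, (p.1 *: p.2 + t); rewrite addrCA; split=> //.
by rewrite rpredD // rpredZ // mem_span.
Qed.

(** Since [finite_dim] asks for a generating list of [S] itself, one is built by induction on [b].
    The part [T] of [S] inside the span of the tail has generators [b']; if [T] is not all of [S],
    any one vector [u] of [S] outside [T] completes them. *)
Lemma finite_dim_sub S b :
  {subset S <= span (fun v => v \in b)} -> finite_dim S.
Proof.
elim: b S => [|v b IHb] S Sb.
  exists [::] => w; apply/idP/idP; first exact: Sb.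
  by apply: span_sub.
pose T : {pred V} := fun w => (w \in S) && (w \in span (fun u => u \in b)).
have T_closed : submod_closed T.
  split; first by apply/andP; rewrite !rpred0.
  move=> a x y /andP[xS xb] /andP[yS yb].
  by apply/andP; rewrite !rpredD ?rpredZ.
pose Tsub : submodClosed V := HB.pack T (GRing.isSubmodClosed.Build K V T T_closed).
have [b' Tb'] : finite_dim T by apply: (IHb Tsub) => w /andP[].
have b'T w : w \in b' -> w \in T by move=> wb'; rewrite Tb'; apply: mem_span.
case: (pselect (exists2 u, u \in S & u \notin span (fun w => w \in b))); last first.
  move=> Sb0; exists b' => w; rewrite -Tb' unfold_in.
  apply/idP/andP => [wS|[]//]; split=> //.
  by apply: contrapT => /negP wNb; apply: Sb0; exists w.
move=> [u uS uNb]; exists (u :: b') => w.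
apply/idP/idP => [wS|]; last first.
  apply: span_sub => x; rewrite inE => /predU1P[->//|/b'T /andP[]//].
have [c [t [tb def_u]]] := span_cons (Sb u uS).
have [d [s [sb def_w]]] := span_cons (Sb w wS).
have c0 : c != 0.
  by apply: contraNneq uNb => c0; rewrite def_u c0 scale0r add0r.
(* The factor [d / c] cancels the component along [v], so the difference falls into [T]. *)
have -> : w = (d / c) *: u + (w - (d / c) *: u) by rewrite addrC subrK.
rewrite rpredD //; first by rewrite rpredZ // mem_span // mem_head.
have: w - (d / c) *: u \in T.
  rewrite unfold_in; apply/andP; split; first by rewrite submodB // rpredZ.
  rewrite def_w def_u scalerDr scalerA divfK // opprD addrACA subrr add0r.
  by rewrite submodB // rpredZ.
rewrite Tb'; apply: span_sub => x xb'.
by rewrite mem_span // inE xb' orbT.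
Qed.

End FiniteDim.

(** * Whittaker pairs from filtrations of a Lie algebra *)

Section LieAlgebraTheory.
Variables (K : fieldType) (L : lieAlgType K).

Lemma span_lie (X Y : L -> Prop) (S : submodClosed L) :
  (forall x y, X x -> Y y -> lie x y \in S) ->
  forall x y, x \in span X -> y \in span Y -> lie x y \in S.
Proof.
move=> XYS x y xX yY; apply: (span_linear_sub (f := lie^~ y)) xX.
  exact: lie_linearl.
move=> x' Xx'; apply: span_linear_sub yY; first exact: lie_linearr.
by move=> y' Yy'; apply: XYS.
Qed.

Lemma quot_mod_pi_linear (N : submodClosed L) :
  linear (fun x => \pi_(quot_mod N) x).
Proof.
move=> a x y /=; rewrite quot_modD; congr (_ + _).
by apply/esym; exact: quot_scale_pi.
Qed.

Lemma quot_mod_pi0 (N : submodClosed L) x :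
  x \in N -> \pi_(quot_mod N) x = 0.
Proof.
move=> xN; have -> : 0 = \pi_(quot_mod N) (0 : L).
  by apply: (@addrI _ (\pi_(quot_mod N) x)); rewrite -quot_modD !addr0.
by apply/quot_modE; rewrite subr0.
Qed.

(* F d stands for the part of degree at least d in a grading of L. *)
Lemma filtered_whittaker_pair (N : submodClosed L) (F : int -> submodClosed L) :
  N =i F 1 ->
  (forall d e x y, x \in F d -> y \in F e -> lie x y \in F (d + e)) ->
  (forall d e, (d <= e)%R -> {subset F e <= F d}) ->
  (forall x, exists d : nat, x \in F (- d%:Z)) ->
  (forall x, (forall d : nat, x \in F d) -> x = 0) ->
  (forall d : nat, exists b : seq L, forall x, x \in F (- d%:Z) ->
     exists2 y, y \in span (fun v => v \in b) & x - y \in N) ->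
  whittaker_pair N.
Proof.
move=> NF lieF subF exhF sepF finF.
have subN : lie_subalgebra N.
  move=> x y; rewrite !NF => xN yN.
  exact: subF (lieF _ _ _ _ xN yN).
split=> //.
  (* The term of index [d] of the lower central series lies in [F d.+1]: the series starts at index
     0 with [N], which is [F 1]. *)
  move=> v vN; apply: sepF => d; apply: (@subF d (d.+1)); first by lia.
  elim: d v {vN}(vN d) => [v /=|d IHd]; first by rewrite NF.
  apply: span_sub => v [x [y [/IHd xF yN ->]]].
  have -> : d.+2%:Z = d.+1%:Z + 1 by lia.
  by rewrite lieF // -NF.
split.
  move=> w; have [d wF] := exhF (repr w); have [b Fb] := finF d.
  rewrite -[w]reprK.
  (* The list [b] represents [F (- d)] modulo [N], and the orbit never leaves the image of
     [F (- d)], because acting by [N] only raises degrees. *)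
  apply: (@finite_dim_sub _ _ _ [seq \pi_(quot_mod N) x | x <- b]).
  apply: span_sub => v [us [usN ->]].
  suff [x xF ->] : exists2 x, x \in F (- d%:Z) &
      foldr (@ad_quot _ _ N) (\pi_(quot_mod N) (repr w)) us = \pi_(quot_mod N) x.
    have [y yb xyN] := Fb x xF.
    have /quot_modE -> := xyN.
    apply: (span_linear_sub (f := fun x => \pi_(quot_mod N) x)) yb.
      exact: quot_mod_pi_linear.
    by move=> z zb; apply: mem_span; apply: map_f.
  elim: us usN => [|u us IHus] usN; first by exists (repr w).
  have uN : u \in N by apply: usN; rewrite mem_head.
  case: IHus => [u' u'us|x xF /= ->]; first by apply: usN; rewrite inE u'us orbT.
  exists (lie u x); last exact: ad_quot_pi.
  by apply: (@subF _ (1 + - d%:Z)); [lia|rewrite lieF // -NF].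
(* Each application of [u] raises the degree by at least 1, so [d.+1] of them carry [F (- d)] into
   [F 1], which vanishes in the quotient. *)
move=> u w uN; have [d wF] := exhF (repr w); exists d.+1 => k lt_dk.
rewrite -[w]reprK.
have -> : iter k (ad_quot u) (\pi_(quot_mod N) (repr w)) =
    \pi_(quot_mod N) (iter k (lie u) (repr w)).
  by elim: k {lt_dk} => //= k ->; rewrite ad_quot_pi.
apply: quot_mod_pi0; rewrite NF; apply: (@subF _ (k%:Z - d%:Z)); first by lia.
elim: k {lt_dk} => [|k IHk] /=; first by rewrite sub0r.
have -> : k.+1%:Z - d%:Z = 1 + (k%:Z - d%:Z) by lia.
by rewrite lieF // -NF.
Qed.

End LieAlgebraTheory.

(** * Coordinates of derivations in the monomial basis *)

Section WittAlgebra.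
Variables (K : fieldType) (n : nat).
Implicit Types (i j k : 'I_n) (m a b : 'X_{1..n}) (D E : witt K n).
Implicit Types (B : 'I_n -> 'X_{1..n} -> bool).

(** The coordinate of $D$ at $x^m \partial/\partial x_i$, because $D = \sum_i D(x_i)\,
    \partial/\partial x_i$. *)
Definition wcoef D i m : K := (D 'X_i)@_m.

Lemma wcoefD D E i m : wcoef (D + E) i m = wcoef D i m + wcoef E i m.
Proof. exact: mcoeffD. Qed.

Lemma wcoefZ c D i m : wcoef (c *: D) i m = c * wcoef D i m.
Proof. exact: mcoeffZ. Qed.

Lemma wcoef0 i m : wcoef 0 i m = 0.
Proof. exact: mcoeff0. Qed.

Lemma wcoefB D E i m : wcoef (D - E) i m = wcoef D i m - wcoef E i m.
Proof. by rewrite -scaleN1r wcoefD wcoefZ mulN1r. Qed.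

Lemma wcoef_sum (I : Type) (r : seq I) (Q : pred I) (F : I -> witt K n) i m :
  wcoef (\sum_(x <- r | Q x) F x) i m = \sum_(x <- r | Q x) wcoef (F x) i m.
Proof.
by apply: (big_morph (fun D => wcoef D i m)) => [D E|];
  rewrite (wcoefD, wcoef0).
Qed.

Lemma mderiv_var i j : ('X_j : {mpoly K[n]})^`M(i) = (i == j)%:R.
Proof.
rewrite mderivX mnm1E eq_sym; case: eqP => [->|_]; last by rewrite scale0r.
by rewrite -[X in (X - _)%MM]add0m addmK mpolyX0 scale1r.
Qed.

Lemma wittD_var i m j : wittD K i m 'X_j = (i == j)%:R *: 'X_[m].
Proof. by rewrite /= mderiv_var mulr_natr scaler_nat. Qed.

Lemma wcoef_wittD i m j b :
  wcoef (wittD K i m) j b = ((i == j) && (m == b))%:R.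
Proof. by rewrite /wcoef wittD_var mcoeffZ mcoeffX -natrM mulnb. Qed.

(** The Leibniz rule gives $D(1) = 0$ and carries the agreement from variables to monomials;
    linearity does the rest. *)
Lemma der_var_inj D E : (forall i, D 'X_i = E 'X_i) -> D = E.
Proof.
move=> DE; apply: derP => p.
have der1 (F : witt K n) : F 1 = 0.
  by apply: (@addrI _ (F 1)); rewrite addr0 -{3}[1]mulr1 derM mulr1 mul1r.
have eqM : {in [pred q | D q == E q] &, forall q r, D (q * r) = E (q * r)}.
  by move=> q r /eqP Dq /eqP Dr; rewrite !derM Dq Dr.
have eqX m : D 'X_[m] = E 'X_[m].
  rewrite mpolyXE_id; apply/eqP.
  apply: (big_ind (fun q => D q == E q)) => [|q r Dq Dr|i _].
  - by rewrite !der1.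
  - by rewrite eqM.
  elim: (m i) => [|e /eqP IHe]; first by rewrite expr0 !der1.
  by rewrite exprS eqM // inE ?DE ?IHe.
rewrite [p]mpolyE.
elim: (msupp p) => [|m s IHs].
  by rewrite big_nil -(scale0r (0 : {mpoly K[n]})) !derZ !scale0r.
by rewrite !big_cons !derD !derZ eqX IHs.
Qed.

Lemma wcoef_inj D E : (forall i m, wcoef D i m = wcoef E i m) -> D = E.
Proof. by move=> DE; apply: der_var_inj => i; apply/mpolyP => m; apply: DE. Qed.

(** The projection onto the span of the basis elements selected by [B], along the others. Summing
    over the support of each $D(x_i)$ keeps the sum finite. *)
Definition wproj B D : witt K n :=
  \sum_i \sum_(m <- msupp (D 'X_i) | B i m) wcoef D i m *: wittD K i m.

Lemma wcoef_wproj B D i m :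
  wcoef (wproj B D) i m = if B i m then wcoef D i m else 0.
Proof.
rewrite wcoef_sum (bigD1 i) //= [X in _ + X]big1 ?addr0 => [|j ji]; last first.
rewrite wcoef_sum big1 // => b _.
  by rewrite wcoefZ wcoef_wittD (negbTE ji) mulr0.
rewrite wcoef_sum.
under eq_bigr => b _ do rewrite wcoefZ wcoef_wittD eqxx /=.
case: (boolP (m \in msupp (D 'X_i))) => [mD|mND].
  rewrite big_mkcond (bigD1_seq m) //= eqxx mulr1 big1 ?addr0 // => b bm.
  by rewrite (negbTE bm) mulr0 if_same.
rewrite /wcoef (memN_msupp_eq0 mND) if_same.
rewrite big_seq_cond big1 // => b /andP[bD _].
by case: eqP bD mND => [-> ->|]; rewrite ?mulr0.
Qed.

(** A span of basis elements described through coordinates, so that membership and directness of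
    sums can be checked one coordinate at a time; [supportedE] recovers the span. *)
Definition supported B : {pred witt K n} :=
  fun D => `[< forall i m, wcoef D i m != 0 -> B i m >].

Lemma supportedP B D :
  reflect (forall i m, wcoef D i m != 0 -> B i m) (D \in supported B).
Proof. exact: asboolP. Qed.

Lemma supported_submod B : submod_closed (supported B).
Proof.
split; first by apply/supportedP => i m; rewrite wcoef0 eqxx.
move=> c D E /supportedP DB /supportedP EB; apply/supportedP => i m.
rewrite wcoefD wcoefZ; apply: contraR => NB.
have /eqP -> : wcoef D i m == 0 by apply: contraR NB; apply: DB.
have /eqP -> : wcoef E i m == 0 by apply: contraR NB; apply: EB.
by rewrite mulr0 addr0.
Qed.
HB.instance Definition _ B :=
  GRing.isSubmodClosed.Build K (witt K n) (supported B) (supported_submod B).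

Lemma supported_wittD B i m : (wittD K i m \in supported B) = B i m.
Proof.
apply/supportedP/idP => [|Bim j b].
  by apply; rewrite wcoef_wittD !eqxx oner_eq0.
by rewrite wcoef_wittD; case: andP => [[/eqP<- /eqP<-]//|]; rewrite eqxx.
Qed.

Lemma supportedE B :
  supported B =i span (fun D => exists i m, B i m /\ D = wittD K i m).
Proof.
move=> D; apply/idP/idP; last first.
  by apply: span_sub => E [i [m [Bim ->]]]; rewrite supported_wittD.
move=> /supportedP DB.
have -> : D = wproj B D.
  apply: wcoef_inj => i m; rewrite wcoef_wproj.
  by case: ifPn => // NB; apply/eqP; apply: contraR NB; apply: DB.
apply: rpred_sum => i _; apply: rpred_sum => m Bim; rewrite rpredZ //.
by apply: mem_span; exists i, m.
Qed.

Lemma wproj_supported B D : wproj B D \in supported B.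
Proof.
by apply/supportedP => i m; rewrite wcoef_wproj; case: ifP => //; rewrite eqxx.
Qed.

Lemma direct_sum3_supported B1 B2 B3 :
  (forall i m, [|| B1 i m, B2 i m | B3 i m]) ->
  (forall i m, ~~ (B1 i m && B2 i m)) ->
  (forall i m, ~~ (B1 i m && B3 i m)) ->
  (forall i m, ~~ (B2 i m && B3 i m)) ->
  direct_sum3 (supported B1) (supported B2) (supported B3).
Proof.
move=> cover disj12 disj13 disj23 D.
exists (wproj B1 D, wproj B2 D, wproj B3 D); split=> [|[[D1 D2] D3]] /=.
  split; try exact: wproj_supported.
  apply: wcoef_inj => i m; rewrite !wcoefD !wcoef_wproj.
  move: (cover i m) (disj12 i m) (disj13 i m) (disj23 i m).
  by case: (B1 i m); case: (B2 i m); case: (B3 i m); rewrite ?addr0 ?add0r.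
move=> [/supportedP D1B /supportedP D2B /supportedP D3B ->].
(* For uniqueness: at each [(i, m)] exactly one of the three predicates holds, so the other two
   components have coordinate 0 there. *)
have outside B E i m : (forall i m, wcoef E i m != 0 -> B i m) ->
    B i m || (wcoef E i m == 0).
  by move=> EB; case: eqP => [|/eqP/EB ->]; rewrite ?orbT.
congr (_, _, _); apply: wcoef_inj => i m; rewrite wcoef_wproj !wcoefD;
  move: (outside B1 D1 i m D1B) (outside B2 D2 i m D2B) (outside B3 D3 i m D3B);
  move: (cover i m) (disj12 i m) (disj13 i m) (disj23 i m);
  case: (B1 i m); case: (B2 i m); case: (B3 i m) => //= _ _ _ _;
  do 3![move=> /eqP ->|move=> _]; by rewrite ?addr0 ?add0r.
Qed.

(** Both sides are compared on the variables. The subtraction of multi-indices is truncated, but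
    where it truncates the scalar in front is 0. *)
Lemma lie_wittD i j a b :
  lie (wittD K i a) (wittD K j b) =
  (b i)%:R *: wittD K j (a + (b - U_(i)))%MM -
  (a j)%:R *: wittD K i (b + (a - U_(j)))%MM.
Proof.
apply: der_var_inj => k.
rewrite -[LHS]/(wittD K i a (wittD K j b 'X_k) - wittD K j b (wittD K i a 'X_k)).
rewrite -[RHS]/((b i)%:R *: wittD K j (a + (b - U_(i)))%MM 'X_k -
  (a j)%:R *: wittD K i (b + (a - U_(j)))%MM 'X_k).
rewrite !wittD_var !derZ /= !mderivX -!scalerAr -!mpolyXD.
by rewrite !scalerA ![_ * (_ == _)%:R]mulrC.
Qed.

End WittAlgebra.

(** * Gradings by weights of the variables *)

Section WittGrading.
Variables (K : fieldType) (n : nat).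
Implicit Types (i j k : 'I_n) (m a b : 'X_{1..n}) (D E : witt K n).
Implicit Types (g : 'I_n -> int) (d e : int).

Definition mwt g m : int := \sum_k g k *+ m k.

(* The degree of x^m d/dx_i when x_k is given the degree g k. *)
Definition wdeg g i m : int := mwt g m - g i.

Lemma mwtD g a b : mwt g (a + b)%MM = mwt g a + mwt g b.
Proof. by rewrite -big_split; apply: eq_bigr => k _; rewrite mnmDE mulrnDr. Qed.

Lemma mwtU g i : mwt g U_(i)%MM = g i.
Proof.
rewrite /mwt (bigD1 i) //= mnm1E eqxx big1 ?addr0 // => k ki.
by rewrite mnm1E eq_sym (negbTE ki).
Qed.

Lemma mwt0 g : mwt g 0%MM = 0.
Proof. by apply: big1 => k _; rewrite mnm0E. Qed.

Lemma mwtN g m : mwt (fun k => - g k) m = - mwt g m.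
Proof. by rewrite -sumrN; apply: eq_bigr => k _; rewrite mulNrn. Qed.

(** Reversing the grading lets one argument serve both nilpotent parts. *)
Lemma wdegN g i m : wdeg (fun k => - g k) i m = - wdeg g i m.
Proof. by rewrite /wdeg mwtN opprD. Qed.

Lemma mwt_ge g c m :
  (forall k, c <= g k) -> c *+ mdeg m <= mwt g m.
Proof.
by move=> cg; rewrite mdegE -sumrMnr; apply: ler_sum => k _; rewrite lerMn2r cg orbT.
Qed.

Definition wfilt g d : {pred witt K n} :=
  supported (fun i m => d <= wdeg g i m).
HB.instance Definition _ g d := GRing.SubmodClosed.on (wfilt g d).

Lemma wfilt_wittD g d i m : (wittD K i m \in wfilt g d) = (d <= wdeg g i m).
Proof. exact: supported_wittD. Qed.

Lemma lie_wfilt g d e D E :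
  D \in wfilt g d -> E \in wfilt g e -> lie D E \in wfilt g (d + e).
Proof.
move=> dD eE; rewrite supportedE in dD; rewrite supportedE in eE.
move: dD eE; apply: span_lie.
move=> _ _ [i [a [da ->]]] [j [b [eb ->]]].
(* Both terms of [lie_wittD] have this shape, the second with the two factors exchanged. If [t k] is
   0 the degree may be wrong, but the term vanishes. *)
have mem_term (k l : 'I_n) (s t : 'X_{1..n}) :
    d + e <= wdeg g k s + wdeg g l t ->
    (t k)%:R *: wittD K l (s + (t - U_(k)))%MM \in wfilt g (d + e).
  move=> le_de; have [->|tk] := eqVneq (t k) 0%N; first by rewrite scale0r rpred0.
  rewrite rpredZ // wfilt_wittD; apply: le_trans le_de _.
  have le_kt : (U_(k) <= t)%MM by rewrite lep1mP.
  by rewrite /wdeg -{1}(submK le_kt) !mwtD mwtU; lia.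
rewrite lie_wittD; apply: submodB; apply: mem_term; last rewrite (addrC d e);
  exact: lerD.
Qed.

Lemma wfilt_sub g d e : d <= e -> {subset wfilt g e <= wfilt g d}.
Proof.
move=> le_de D /supportedP De; apply/supportedP => i m /De.
exact: le_trans.
Qed.

(** Only finitely many coordinates are nonzero; the sum of the absolute values of their degrees
    bounds each of them. *)
Lemma wfilt_exhaustive g D : exists d : nat, D \in wfilt g (- d%:Z).
Proof.
exists (\sum_i \sum_(m <- msupp (D 'X_i)) `|wdeg g i m|)%N.
apply/supportedP => i m; rewrite -mcoeff_msupp => mD.
set s := (\sum_i _)%N; suff : (`|wdeg g i m| <= s)%N by lia.
rewrite {}/s.
by rewrite (bigD1 i) //= (bigD1_seq m) //= -addnA leq_addr.
Qed.

Lemma wfilt_separated g D : (forall d : nat, D \in wfilt g d) -> D = 0.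
Proof.
move=> Dg; apply: wcoef_inj => i m; rewrite wcoef0; apply/eqP/negPn/negP => Dim.
have /supportedP/(_ i m Dim) := Dg `|wdeg g i m|.+1; lia.
Qed.

Lemma wfilt_finite_codim g (d : nat) N :
  (forall m, (mdeg m <= `|mwt g m|)%N) ->
  {subset wfilt g 1 <= N} ->
  exists s : seq (witt K n), forall D, D \in wfilt g (- d%:Z) ->
    exists2 E, E \in span (fun F => F \in s) & D - E \in (N : {pred witt K n}).
Proof.
(* If $x^m \partial/\partial x_i$ has degree between $-d$ and 0, then [mwt g m] is at most $d +
   |g_i|$ in absolute value, so [mdeg m] is below [M]. The witness for [E] is the part of [D] of
   degree at most 0. *)
move=> mdeg_le subN; pose M := (d + \sum_i `|g i|).+1.
exists [seq wittD K i (bmnm c) | i <- enum 'I_n, c <- enum {: 'X_{1..n < M}}].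
move=> D /supportedP Dd; exists (wproj (fun i m => wdeg g i m < 1) D); last first.
  apply/subN/supportedP => i m; rewrite wcoefB wcoef_wproj.
  by rewrite ltNge; case: leP => //=; rewrite subrr eqxx.
pose B i m := (- d%:Z <= wdeg g i m) && (wdeg g i m < 1).
have : wproj (fun i m => wdeg g i m < 1) D \in supported B.
  apply/supportedP => i m; rewrite wcoef_wproj.
  by case: ifP => [lt1 /Dd d_le|]; rewrite ?eqxx // /B d_le lt1.
rewrite supportedE; apply: span_sub => _ [i [m [/andP[ge_d lt1] ->]]].
have ltM : (mdeg m < M)%N.
  have : (`|g i| <= \sum_i `|g i|)%N by rewrite (bigD1 i) //= leq_addr.
  by have := mdeg_le m; rewrite /M; move: ge_d lt1; rewrite /wdeg; lia.
apply: mem_span; apply/allpairsPdep; exists i, (BMultinom ltM).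
by rewrite !mem_enum.
Qed.

Lemma wfilt_whittaker_pair (N : submodClosed (witt K n)) g :
  (forall m, (mdeg m <= `|mwt g m|)%N) -> N =i wfilt g 1 -> whittaker_pair N.
Proof.
move=> mdeg_le NF.
apply: (@filtered_whittaker_pair _ _ N (fun d => wfilt g d)) => //.
- exact: lie_wfilt.
- exact: wfilt_sub.
- exact: wfilt_exhaustive.
- exact: wfilt_separated.
by move=> d; apply: wfilt_finite_codim => // D; rewrite NF.
Qed.

(** * The three summands as graded parts *)

Section TriangularDecomposition.
Variables (P : rel 'I_n) (hP : positive_system P).

(* The first summand is strictly monotone along P, so x_i d/dx_j has positive
   degree iff P i j; the shift by 2n + 1 makes every d/dx_i positive and every
   x^m d/dx_i with |m| >= 2 negative. *)
Definition rootdeg i : int := #|[pred l | P i l]|%:Z - n.*2.+1%:Z.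

Lemma rootdeg_bounds i :
  - n.*2.+1%:Z <= rootdeg i <= - n.+1%:Z.
Proof.
have : (#|[pred l | P i l]| <= n)%N by rewrite -[leqRHS]card_ord max_card.
by rewrite /rootdeg; lia.
Qed.

(** By transitivity the set counted for [j] is contained in the one for [i]; the inclusion is strict
    because [j] belongs only to the latter, by irreflexivity. *)
Lemma rootdeg_lt i j : P i j -> rootdeg j < rootdeg i.
Proof.
case: hP => irrP _ trP Pij.
suff : (#|[pred l | P j l]| < #|[pred l | P i l]|)%N by rewrite /rootdeg; lia.
apply: proper_card; apply/properP; split.
  by apply/subsetP => l; rewrite !inE; apply: trP.
by exists j; rewrite !inE // irrP.
Qed.

Lemma root_trichotomy i j : [\/ i = j, P i j | P j i].
Proof.
case: hP => _ asymP _; have [->|ij] := eqVneq i j; first exact: Or31.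
have := asymP i j ij; case: (P i j) => [_|/esym/negbFE Pji]; first exact: Or32.
exact: Or33.
Qed.

Lemma wdegU i j : wdeg rootdeg j U_(i)%MM = rootdeg i - rootdeg j.
Proof. by rewrite /wdeg mwtU. Qed.

Lemma wdeg0_gt0 i : 0 < wdeg rootdeg i 0%MM.
Proof. by rewrite /wdeg mwt0; have := rootdeg_bounds i; lia. Qed.

Lemma mwt_rootdeg_le m : mwt rootdeg m <= - (n.+1%:Z *+ mdeg m).
Proof.
rewrite lerNr -mwtN; apply: mwt_ge => k; have := rootdeg_bounds k; lia.
Qed.

(** The degree is at most $-2(n+1) + (2n+1) = -1$, by the two bounds on [rootdeg]. *)
Lemma wdeg_lt0 i m : (1 < mdeg m)%N -> wdeg rootdeg i m < 0.
Proof.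
move=> m_gt1; have := mwt_rootdeg_le m; have := rootdeg_bounds i.
rewrite /wdeg pmulrn mulrzz; nia.
Qed.

Lemma mdeg_le_mwt m : (mdeg m <= `|mwt rootdeg m|)%N.
Proof. have := mwt_rootdeg_le m; rewrite pmulrn mulrzz; nia. Qed.

(** Sorts the basis elements into the partial derivatives, those of $\mathfrak{gl}_n$, and those of
    higher order. *)
Lemma mdegP m : [\/ m = 0%MM, exists k, m = U_(k)%MM | (1 < mdeg m)%N].
Proof.
case: (ltngtP (mdeg m) 1) => [|m_gt1|/eqP].
- by rewrite ltnS leqn0 mdeg_eq0 => /eqP->; apply: Or31.
- exact: Or33.
by rewrite mdeg_eq1 => /existsP[k /eqP->]; apply: Or32; exists k.
Qed.

Lemma witt_plusE : witt_plus K P =i wfilt rootdeg 1.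
Proof.
move=> D; apply/idP/idP.
  apply: span_sub => {D}D [|[i ->]]; last first.
    by rewrite wfilt_wittD; have := wdeg0_gt0 i; lia.
  apply: span_sub => _ [i [j [Pij ->]]]; rewrite wfilt_wittD wdegU.
  have := rootdeg_lt Pij; lia.
move=> DF; rewrite supportedE in DF; move: D DF.
apply: span_sub => _ [i [m [deg_gt0 ->]]].
apply: mem_span; case: (mdegP m) deg_gt0 => [->|[k ->]|/(wdeg_lt0 i)]; last by lia.
  by right; exists i.
rewrite wdegU => deg_gt0; left; apply: mem_span; exists k, i; split=> //.
by case: (root_trichotomy k i) deg_gt0 => [->||/rootdeg_lt]; lia.
Qed.

(** Distinct indices are comparable under [P], hence have distinct [rootdeg]; so $x_k\,
    \partial/\partial x_i$ has degree 0 only for $k = i$. *)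
Lemma witt_hE : witt_h K n =i supported (fun i m => wdeg rootdeg i m == 0).
Proof.
move=> D; apply/idP/idP.
  by apply: span_sub => _ [i ->]; rewrite supported_wittD wdegU subrr.
rewrite supportedE; apply: span_sub => _ [i [m [/eqP deg0 ->]]].
apply: mem_span; exists i; congr wittD.
case: (mdegP m) deg0 => [->|[k ->]|/(wdeg_lt0 i)]; last by lia.
  by have := wdeg0_gt0 i; lia.
by rewrite wdegU; case: (root_trichotomy k i) => [->//|/rootdeg_lt|/rootdeg_lt]; lia.
Qed.

Lemma witt_gl_mdeg D :
  D \in witt_gl K n -> D \in supported (fun _ m => mdeg m == 1%N).
Proof.
by apply: span_sub => _ [i [j ->]]; rewrite supported_wittD mdeg1.
Qed.

Lemma witt_minusE : witt_minus K P =i wfilt (fun k => - rootdeg k) 1.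
Proof.
move=> D; apply/idP/idP.
  apply: span_sub => {D}D [|[i [m [-> Ngl Nplus]]]].
    apply: span_sub => _ [i [j [Pji ->]]]; rewrite wfilt_wittD wdegN wdegU.
    have := rootdeg_lt Pji; lia.
  rewrite wfilt_wittD wdegN.
  (* The two exclusions leave only $|m| \ge 2$: the partial derivatives lie in $\mathfrak{n}_+$, the
     elements with $|m| = 1$ in $\mathfrak{gl}_n$. *)
  case: (mdegP m) Ngl Nplus => [->|[k ->]|/(wdeg_lt0 i)]; last by lia.
    by rewrite witt_plusE wfilt_wittD; have := wdeg0_gt0 i; lia.
  by move=> /negP[]; apply: mem_span; exists k, i.
move=> DF; rewrite supportedE in DF; move: D DF.
apply: span_sub => _ [i [m [deg_lt0 ->]]].
move: deg_lt0; rewrite wdegN => deg_lt0.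
apply: mem_span; case: (mdegP m) deg_lt0 => [->|[k ->]|m_gt1 deg_lt0].
- by have := wdeg0_gt0 i; lia.
- rewrite wdegU => deg_lt0; left; apply: mem_span; exists k, i; split=> //.
  by case: (root_trichotomy k i) deg_lt0 => [->|/rootdeg_lt|]; lia.
right; exists i, m; split=> //.
  by apply/negP => /witt_gl_mdeg; rewrite supported_wittD; lia.
by rewrite witt_plusE wfilt_wittD; lia.
Qed.

(** Degree 0 means degree at least 0 for both the grading and its reverse, and each of these two
    conditions is stable under brackets. *)
Lemma witt_h_subalgebra : lie_subalgebra (witt_h K n).
Proof.
have hE D : (D \in witt_h K n) =
    (D \in wfilt rootdeg 0) && (D \in wfilt (fun k => - rootdeg k) 0).
  rewrite witt_hE; apply/supportedP/andP =>
    [D0|[/supportedP Dge /supportedP Dle] i m Dim].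
    by split; apply/supportedP => i m /D0/eqP; rewrite ?wdegN => ->.
  by apply/eqP; move: (Dge i m Dim) (Dle i m Dim); rewrite wdegN; lia.
move=> D E; rewrite !hE => /andP[Dge Dle] /andP[Ege Ele].
by rewrite -[0]addr0 !lie_wfilt.
Qed.

Lemma witt_direct_sum :
  direct_sum3 (witt_minus K P) (witt_h K n) (witt_plus K P).
Proof.
(* Extensionality turns the pointwise descriptions into equalities of predicates; what remains is
   the trichotomy of the sign of an integer degree. *)
have -> : witt_minus K P = wfilt (fun k => - rootdeg k) 1.
  by apply/funext => D; exact: witt_minusE.
have -> : witt_h K n = supported (fun i m => wdeg rootdeg i m == 0).
  by apply/funext => D; exact: witt_hE.
have -> : witt_plus K P = wfilt rootdeg 1.
  by apply/funext => D; exact: witt_plusE.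
by apply: direct_sum3_supported => i m; rewrite ?wdegN; lia.
Qed.

Lemma witt_plus_whittaker : whittaker_pair (witt_plus K P).
Proof. exact: wfilt_whittaker_pair mdeg_le_mwt witt_plusE. Qed.

Lemma witt_minus_whittaker : whittaker_pair (witt_minus K P).
Proof.
apply: wfilt_whittaker_pair witt_minusE => m.
by rewrite mwtN abszN mdeg_le_mwt.
Qed.

End TriangularDecomposition.
End WittGrading.

Theorem proposition41 (R : realType) (n : nat) (hn : (1 <= n)%N)
    (P : rel 'I_n) (hP : positive_system P) :
  ([/\ lie_subalgebra (witt_minus R[i] P),
       lie_subalgebra (witt_h R[i] n),
       lie_subalgebra (witt_plus R[i] P) &
       direct_sum3 (witt_minus R[i] P) (witt_h R[i] n) (witt_plus R[i] P)])
  /\ (whittaker_pair (witt_minus R[i] P) /\ whittaker_pair (witt_plus R[i] P)).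
Proof.
have minusW := witt_minus_whittaker R[i] hP.
have plusW := witt_plus_whittaker R[i] hP.
split=> //; split; [by case: minusW | exact: witt_h_subalgebra hP |
  by case: plusW | exact: witt_direct_sum].
Qed.
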